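(* Let $\Phi=(\phi_n)$, $\Psi=(\psi_n)$ be sequences in $\mathcal H$ and let $m=(m_n)$ be a complex scalar sequence such that $M_{m,\Phi,\Psi}$ is unconditionally convergent and invertible. If $\Phi$ is minimal, then both of the following hold. $\widetilde{\mathcal P}_2$: there exist scalar sequences $(c_n)$ and $(d_n)$ with $m_n=c_n\overline{d_n}$ for every $n$ such that $(c_n\phi_n)$ and $(d_n\psi_n)$ are $\|\cdot\|$-semi-normalized and frames for $\mathcal H$. $\widetilde{\mathcal P}_3$: there exist scalar sequences $(c_n)$ and $(d_n)$ with $m_n=c_n\overline{d_n}$ for every $n$ such that $(c_n\phi_n)$ and $(d_n\psi_n)$ are frames for $\mathcal H$.
   Context: $\mathcal H$ is a complex Hilbert space having an orthonormal basis $(e_n)_{n\in\mathbb N}$ indexed by $\mathbb N$; all sequences and sums are indexed by $\mathbb N$. The multiplier is $M_{m,\Phi,\Psi}f=\sum_{n=1}^\infty m_n\langle f,\psi_n\rangle\phi_n$, where $\langle\cdot,\cdot\rangle$ is linear in the first argument. It is unconditionally convergent if for every $f\in\mathcal H$ the series converges unconditionally (i.e. it converges for every permutation of its terms). It is invertible if the resulting linear operator $M:\mathcal H\to\mathcal H$ has a bounded operator $M^{-1}:\mathcal H\to\mathcal H$ with $MM^{-1}=M^{-1}M=I_{\mathcal H}$. A sequence $\Phi$ is minimal if for every $k$, $\phi_k$ does not belong to the closed linear span of $\{\phi_n\}_{n\ne k}$. A sequence $(\phi_n)$ in $\mathcal H$ is $\|\cdot\|$-semi-normalized if there are constants $0<a\le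 b<\infty$ with $a\le\|\phi_n\|\le b$ for all $n$. It is a frame for $\mathcal H$ if there are constants $0<A\le B<\infty$ with $A\|h\|^2\le\sum_n|\langle h,\phi_n\rangle|^2\le B\|h\|^2$ for all $h\in\mathcal H$. *)

(* Defs.v *)
From mathcomp Require Import all_boot all_order all_algebra.
From mathcomp Require Import all_classical all_reals all_analysis.
From mathcomp.real_closed Require Import complex.
Set Implicit Arguments.
Unset Strict Implicit.
Unset Printing Implicit Defensive.
Import Order.TTheory GRing.Theory Num.Theory.
Import numFieldNormedType.Exports.
Local Open Scope classical_set_scope.
Local Open Scope ring_scope.
Local Open Scope complex_scope.

(* A complex Hilbert space is a complete normed module [H] over [R[i]] together
   with a positive definite form [dot : {dot H for Num.conj}], which is linear in
   its first argument, such that [inner_norm dot] holds. The index set {1, 2, ...}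
   is encoded as [nat]. *)

(* The library norm of a normed module over [R[i]] is a nonnegative real element
   of [R[i]]; [rnorm] is the same number as an element of [R]. *)
Definition rnorm {R : realType} {V : normedZmodType R[i]} (x : V) : R :=
  complex.Re `|x|.

Section Spans.
Context {R : realType} {H : normedModType R[i]}.

Definition lin_span (A : set H) : set H :=
  [set x | exists (n : nat) (c : 'I_n -> R[i]) (v : 'I_n -> H),
     (forall i, A (v i)) /\ x = \sum_(i < n) c i *: v i].

Definition minimal_seq (phi : nat -> H) : Prop :=
  forall k, ~ closure (lin_span (phi @` [set n | n <> k])) (phi k).

Definition semi_normalized (phi : nat -> H) : Prop :=
  exists a b : R,
    [/\ 0 < a, a <= b & forall n, a <= rnorm (phi n) <= b].

Definition unconditionally_convergent (u : nat -> H) : Prop :=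
  forall s : nat -> nat, bijective s -> cvgn (series (u \o s)).

Definition bounded_operator (N : {linear H -> H}) : Prop :=
  exists C : R, forall x, rnorm (N x) <= C * rnorm x.

Definition invertible_operator (M : H -> H) : Prop :=
  exists N : {linear H -> H},
    [/\ bounded_operator N, M \o N = idfun & N \o M = idfun].

End Spans.

Section InnerProduct.
Context {R : realType} {H : normedModType R[i]}.
Variable dot : {dot H for Num.conj}.

Definition inner_norm : Prop := forall x, dot x x = `|x| ^+ 2.

Definition orthonormal_basis (e : nat -> H) : Prop :=
  (forall i j, dot (e i) (e j) = (i == j)%:R) /\
  closure (lin_span (range e)) = setT.

Definition frame (phi : nat -> H) : Prop :=
  exists A B : R, [/\ 0 < A, A <= B & forall h,
    ((A * rnorm h ^+ 2)%:E <= \sum_(n <oo) (rnorm (dot h (phi n)) ^+ 2)%:E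
       <= (B * rnorm h ^+ 2)%:E)%E].

Definition multiplier_term (m : nat -> R[i]) (phi psi : nat -> H) (f : H) :
  nat -> H := fun n => (m n * dot f (psi n)) *: phi n.

Definition multiplier (m : nat -> R[i]) (phi psi : nat -> H) (f : H) : H :=
  limn (series (multiplier_term m phi psi f)).

Definition multiplier_unconditionally_convergent
    (m : nat -> R[i]) (phi psi : nat -> H) : Prop :=
  forall f, unconditionally_convergent (multiplier_term m phi psi f).

End InnerProduct.

(* Main.v *)
Require Import Defs.
From HB Require Import structures.
From mathcomp Require Import all_boot all_order all_algebra.
From mathcomp Require Import all_classical all_reals all_analysis.
From mathcomp.real_closed Require Import complex.
From mathcomp Require Import ring lra.
Set Implicit Arguments.
Unset Strict Implicit.
Unset Printing Implicit Defensive.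
Import Order.TTheory GRing.Theory Num.Theory.
Import numFieldNormedType.Exports.
Local Open Scope ring_scope.
Local Open Scope complex_scope.

(* Put u_n = phi_n / |phi_n| and w_n = conj(m_n) |phi_n| psi_n, so that the
   multiplier is M f = sum_n <f, w_n> u_n, and let N = M^-1. Minimality and
   phi_j = M N phi_j give <N u_j, w_k> = delta_jk. Unconditional convergence and
   the uniform boundedness principle bound all signed partial sums
   sum_(k < n) +-<f, w_k> u_k by K |f|. By the parallelogram law some choice of
   signs has squared norm at least sum_(k < n) |<f, w_k>|^2, so w is Bessel; and
   some choice of signs in sum_(k < n) +-a_k u_k has squared norm at most
   sum_(k < n) |a_k|^2, while undoing the signs costs a factor K |N|, so the
   synthesis operator of u is bounded. The lower frame bounds then follow from
   M N = N M = 1. *)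

(** * The norm as an element of [R] *)

Section RealNorm.
Context {R : realType} {V : normedZmodType R[i]}.
Implicit Types x y : V.

Lemma rnormE x : (rnorm x)%:C = `|x|.
Proof. by rewrite /rnorm RRe_real// normr_real. Qed.

Lemma rnorm_ge0 x : 0 <= rnorm x.
Proof. by rewrite -ler0c rnormE. Qed.

Lemma rnorm0 : rnorm (0 : V) = 0.
Proof. by rewrite /rnorm normr0. Qed.

Lemma rnorm0_eq0 x : rnorm x = 0 -> x = 0.
Proof. by move=> x0; apply/normr0_eq0; rewrite -rnormE x0. Qed.

Lemma rnormN x : rnorm (- x) = rnorm x.
Proof. by rewrite /rnorm normrN. Qed.

Lemma rnormBC x y : rnorm (x - y) = rnorm (y - x).
Proof. by rewrite /rnorm distrC. Qed.

Lemma rnormD x y : rnorm (x + y) <= rnorm x + rnorm y.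
Proof. by rewrite -lecR rmorphD/= !rnormE ler_normD. Qed.

Lemma rnormB x y : rnorm (x - y) <= rnorm x + rnorm y.
Proof. by rewrite -[rnorm y]rnormN rnormD. Qed.

Lemma rnormBD x y z : rnorm (x - y) <= rnorm (x - z) + rnorm (z - y).
Proof. by rewrite (le_trans _ (rnormD _ _))// addrA subrK. Qed.

Lemma rnorm_sum (I : Type) (r : seq I) (P : pred I) (F : I -> V) :
  rnorm (\sum_(i <- r | P i) F i) <= \sum_(i <- r | P i) rnorm (F i).
Proof.
elim/big_ind2 : _ => [|a x b y xa yb|//]; first by rewrite rnorm0.
by rewrite (le_trans (rnormD _ _))// lerD.
Qed.

End RealNorm.

Lemma rnormM (R : realType) (a b : R[i]) : rnorm (a * b) = rnorm a * rnorm b.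
Proof. by apply: complexI; rewrite rmorphM/= !rnormE normrM. Qed.

Lemma rnorm_conj (R : realType) (a : R[i]) : rnorm (Num.conj a) = rnorm a.
Proof. by rewrite /rnorm norm_conjC. Qed.

Lemma rnorm_real (R : realType) (a : R) : 0 <= a -> rnorm a%:C = a.
Proof. by move=> a0; rewrite /rnorm ger0_norm// ler0c. Qed.

Section RealNormModule.
Local Open Scope classical_set_scope.
Local Open Scope ring_scope.
Context {R : realType} {V : normedModType R[i]}.
Implicit Types x y : V.

Lemma rnormZ (a : R[i]) x : rnorm (a *: x) = rnorm a * rnorm x.
Proof. by apply: complexI; rewrite rmorphM/= !rnormE normrZ. Qed.

Lemma rnorm_sign (b : bool) x : rnorm ((-1) ^+ b *: x) = rnorm x.
Proof. by case: b; rewrite ?scaleN1r ?scale1r ?rnormN. Qed.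

(** Positive elements of [R[i]] are real, so [eps] may range over [R] alone. *)
Lemma cvgn_rnormP (u : nat -> V) (l : V) : u n @[n --> \oo] --> l <->
  forall eps : R, 0 < eps -> exists N, forall n, (N <= n)%N -> rnorm (l - u n) < eps.
Proof.
split.
  move=> /cvgrPdist_lt ul eps e0.
  have /ul[N _ uN] : 0 < eps%:C by rewrite ltcR.
  by exists N => n /uN; rewrite -rnormE ltcR.
move=> ul; apply/cvgrPdist_lt => eps e0.
have eR : eps = (complex.Re eps)%:C by rewrite RRe_real// gtr0_real.
have /ul[N uN] : 0 < complex.Re eps by rewrite -ltcR -eR.
by exists N => // n /= Nn; rewrite eR -rnormE ltcR uN.
Qed.

Lemma rnorm_lim_le (u : nat -> V) (l : V) (B : R) :
  u n @[n --> \oo] --> l -> (\forall n \near \oo, rnorm (u n) <= B) ->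
  rnorm l <= B.
Proof.
move=> /cvgn_rnormP ul [N _ uB]; apply/ler_addgt0Pr => eps /ul[M uM].
have := rnormD (u (N + M)%N) (l - u (N + M)%N).
rewrite addrC subrK => /le_trans; apply; apply: lerD.
  by apply: uB => /=; rewrite leq_addr.
by rewrite ltW// uM// leq_addl.
Qed.

Lemma rnorm_lim_sqr_le (u : nat -> V) (B : R) : cvgn u ->
  (forall n, rnorm (u n) ^+ 2 <= B) -> rnorm (limn u) ^+ 2 <= B.
Proof.
move=> ul uB; have B0 : 0 <= B by apply: le_trans (uB 0%N); rewrite sqr_ge0.
have : rnorm (limn u) <= Num.sqrt B.
  apply: rnorm_lim_le ul _; apply: nearW => n.
  by rewrite -[leLHS]ger0_norm ?rnorm_ge0// -sqrtr_sqr ler_wsqrtr.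
by rewrite -(@ler_pXn2r _ 2) ?nnegrE ?rnorm_ge0 ?sqrtr_ge0// sqr_sqrtr.
Qed.

Lemma closure_rnorm (A : set V) x :
  (forall eps : R, 0 < eps -> exists2 y, A y & rnorm (x - y) < eps) ->
  closure A x.
Proof.
move=> xA B /nbhs_normP[eps /= e0 xB].
have eR : eps = (complex.Re eps)%:C by rewrite RRe_real// gtr0_real.
have /xA[y Ay xy] : 0 < complex.Re eps by rewrite -ltcR -eR.
by exists y; split => //; apply: xB => /=; rewrite eR -rnormE ltcR.
Qed.

End RealNormModule.

Lemma cauchy_rnorm_cvgn (R : realType) (V : completeNormedModType R[i])
    (u : nat -> V) :
  (forall eps : R, 0 < eps ->
    exists N, forall n, (N <= n)%N -> rnorm (u N - u n) < eps) ->
  cvgn u.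
Proof.
move=> uC; apply/cauchy_cvgP; apply: cauchy_exP => eps e0.
have eR : eps = (complex.Re eps)%:C by rewrite RRe_real// gtr0_real.
have /uC[N uN] : 0 < complex.Re eps by rewrite -ltcR -eR.
exists (u N); exists N => // n /= Nn.
by rewrite -ball_normE /= eR -rnormE ltcR uN.
Qed.

(** * Norm and inner product *)

Section InnerProductNorm.
Local Open Scope classical_set_scope.
Local Open Scope ring_scope.
Context {R : realType} {H : normedModType R[i]}.
Variable dot : {dot H for Num.conj}.
Hypothesis hdot : inner_norm dot.
Implicit Types x y : H.

Lemma rnorm_dot_self x : rnorm (dot x x) = rnorm x ^+ 2.
Proof.
by rewrite hdot; apply: complexI; rewrite rnormE rmorphXn/= rnormE normrX normr_id.
Qed.

Lemma rnorm_sqr x : rnorm x ^+ 2 = complex.Re (dot x x).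
Proof.
by rewrite -rnorm_dot_self; apply: complexI; rewrite rnormE ger0_norm ?RRe_real ?ger0_real.
Qed.

Lemma rnorm_parallelogram x y :
  rnorm (x + y) ^+ 2 + rnorm (x - y) ^+ 2 = (rnorm x ^+ 2 + rnorm y ^+ 2) *+ 2.
Proof.
rewrite !rnorm_sqr -!raddfD/= -raddfMn/= dnormD dnormB; congr complex.Re.
by rewrite addrACA addrN addr0 -mulr2n.
Qed.

(** Pythagoras: subtracting from [x] its projection [a *: y] leaves [z] orthogonal to [y], so
    [|a|^2 <y, y>] is at most [<x, x>]. *)
Lemma cauchy_schwarz x y : rnorm (dot x y) <= rnorm x * rnorm y.
Proof.
have [->|y0] := eqVneq y 0.
  by rewrite linear0r !rnorm0 mulr0.
have yy0 : dot y y != 0 by rewrite dnorm_eq0.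
pose a := dot x y / dot y y; pose z := x - a *: y.
have zy : dot z y = 0 by rewrite linearBl linearZl_LR/= divfK// subrr.
have xx : dot x x = dot z z + `|a| ^+ 2 * dot y y.
  rewrite -dnormZ -hnormDd ?subrK//.
  by rewrite linearZr_LR/= [X in _ * X]zy mulr0.
rewrite -lecR rmorphM/= !rnormE -(@ler_pXn2r _ 2) ?nnegrE ?mulr_ge0//.
rewrite exprMn -!hdot xx mulrDl -mulrA -expr2.
rewrite -[dot y y ^+ 2]ger0_norm ?exprn_ge0 ?dnorm_ge0//.
rewrite normrX -exprMn -normrM divfK// lerDr mulr_ge0// dnorm_ge0.
Qed.

Lemma rnorm_dot_lim_le (x y : H) (v : nat -> H) (B : R) : v @ \oo --> x ->
  (forall n, rnorm (dot y (v n)) <= B) -> rnorm (dot y x) <= B.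
Proof.
move=> /cvgn_rnormP vx vB; apply/ler_addgt0Pr => eps e0.
(* Adding 1 keeps the divisor positive even when [y] is zero. *)
have y1 : 0 < rnorm y + 1 by rewrite ltr_wpDl// rnorm_ge0.
have [|N vN] := vx (eps / (rnorm y + 1)); first exact: divr_gt0.
have := rnormD (dot y (v N)) (dot y (x - v N)).
rewrite -linearDr addrC subrK => /le_trans; apply; apply: lerD => //.
apply: le_trans (cauchy_schwarz _ _) _.
have := ltW (vN N (leqnn N)); rewrite ler_pdivlMr// mulrC; apply: le_trans.
by rewrite ler_wpM2r ?rnorm_ge0// lerDl.
Qed.

End InnerProductNorm.

(** * Series expansions along a minimal sequence *)

Section MinimalSequences.
Local Open Scope classical_set_scope.
Local Open Scope ring_scope.
Context {R : realType} {H : normedModType R[i]}.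

Lemma minimal_seq_neq0 (phi : nat -> H) k : minimal_seq phi -> phi k != 0.
Proof.
move=> hmin; apply/eqP => pk0; apply: (hmin k); apply: subset_closure.
by exists 0%N, (fun=> 0), (fun=> 0); split; [case|rewrite big_ord0].
Qed.

(** If [a k] were nonzero, dividing the partial sums by it would exhibit [phi k] as a limit of
    combinations of the other vectors. *)
Lemma minimal_series_coef0 (phi : nat -> H) (a : nat -> R[i]) :
  minimal_seq phi -> series (fun n => a n *: phi n) @ \oo --> (0 : H) ->
  forall k, a k = 0.
Proof.
move=> hmin /cvgn_rnormP a0 k; apply: contrapT => /eqP ak0; apply: (hmin k).
apply: closure_rnorm => eps e0.
have rak : 0 < rnorm (a k).
  by rewrite lt_neqAle rnorm_ge0 andbT eq_sym; apply: contraNneq ak0 => /rnorm0_eq0 ->.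
have [|N Na] := a0 (eps * rnorm (a k)); first exact: mulr_gt0.
pose n := (N + k.+1)%N; pose b i := if i == k then 0 else - (a k)^-1 * a i.
(* Position [k] carries the coefficient 0 but still needs a vector of index other than [k]; [k.+1]
   is a placeholder. *)
exists (\sum_(i < n) b i *: phi (if val i == k then k.+1 else i)).
  exists n, (fun i : 'I_n => b i), (fun i : 'I_n => phi (if val i == k then k.+1 else i)).
  split=> // i; eexists; last by [].
  by case: eqP => //= _; rewrite /= => /eqP; rewrite gtn_eqF.
have -> : phi k - \sum_(i < n) b i *: phi (if val i == k then k.+1 else i) =
    (a k)^-1 *: series (fun n => a n *: phi n) n.
  have kn : (k < n)%N by rewrite leq_addl.
  rewrite /series/= big_mkord (bigD1 (Ordinal kn))//= [in RHS](bigD1 (Ordinal kn))//=.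
  rewrite /b eqxx scale0r add0r.
  rewrite scalerDr scalerA mulVf// scale1r; congr (_ + _).
  rewrite -sumrN scaler_sumr; apply: eq_bigr => i; rewrite -val_eqE/= => /negPf ->.
  by rewrite mulNr scaleNr opprK scalerA.
rewrite rnormZ.
have -> : rnorm (a k)^-1 = (rnorm (a k))^-1.
  by apply: complexI; rewrite fmorphV/= !rnormE normfV.
rewrite ltr_pdivrMl// mulrC.
by have := Na n (leq_addr _ _); rewrite sub0r rnormN.
Qed.

(** Subtracting 1 from the [j]-th coefficient gives a series tending to 0. The expansion of [phi j]
    as [M (N (phi j))] then yields biorthogonality. *)
Lemma minimal_seq_coef (phi : nat -> H) (a : nat -> R[i]) (j : nat) :
  minimal_seq phi ->
  series (fun n => a n *: phi n) @ \oo --> phi j ->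
  forall k, a k = (j == k)%:R.
Proof.
move=> hmin /cvgn_rnormP aj k; apply/eqP; rewrite -subr_eq0; apply/eqP; move: k.
apply: (minimal_series_coef0 (a := fun k => a k - (j == k)%:R) hmin).
apply/cvgn_rnormP => eps /aj[N Na].
exists (N + j.+1)%N => n Nn.
have -> : \sum_(0 <= k < n) (a k - (j == k)%:R) *: phi k =
    \sum_(0 <= k < n) a k *: phi k - phi j.
  under eq_bigr do rewrite scalerBl.
  rewrite sumrB; congr (_ - _).
  rewrite (big_rem j) ?mem_index_iota ?(leq_trans _ Nn) ?leq_addl//=.
  rewrite eqxx scale1r big_seq big1 ?addr0// => k.
  by rewrite mem_rem_uniq ?iota_uniq// inE eq_sym => /andP[/negPf -> _]; rewrite scale0r.
by rewrite sub0r opprB Na// (leq_trans _ Nn)// leq_addr.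
Qed.

End MinimalSequences.

(* Concatenates the blocks [p, g p) for p = 0, g 0, g (g 0), ..., listing in each
   block first the indices satisfying [P p]. *)
Lemma bijective_blocks (g : nat -> nat) (P : nat -> pred nat) :
  (forall N, (N < g N)%N) ->
  exists2 s : nat -> nat, bijective s & forall N, exists p q,
    [/\ (N <= p)%N, (p <= q)%N &
        map s (index_iota p q) = [seq i <- index_iota p (g p) | P p i]].
Proof.
move=> gP; pose b k := iter k g 0%N.
have bS k : (b k < b k.+1)%N by exact: gP.
have b_mono : {mono b : i j / (i <= j)%N}.
  exact: (@leq_mono b (homo_ltn ltn_trans bS)).
have leb k : (k <= b k)%N by elim: k => // k IH; exact: leq_ltn_trans (bS k).
have ex n : exists k, (n < b k.+1)%N by exists n; exact: leq_ltn_trans (leb n) _.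
(* [bl n] is the index of the block from [b k] to [b k.+1] (excluded) that contains [n]. *)
pose bl n := ex_minn (ex n).
have blP n : (b (bl n) <= n < b (bl n).+1)%N.
  rewrite /bl; case: ex_minnP => -[|k] -> kmin; rewrite andbT//.
  by rewrite leqNgt; apply/negP => /kmin; rewrite ltnn.
have blE n k : (b k <= n < b k.+1)%N -> bl n = k.
  move=> /andP[kn nk]; have /andP[ln nl] := blP n.
  have := leq_ltn_trans kn nl; have := leq_ltn_trans ln nk.
  by rewrite !(leqW_mono b_mono) !ltnS => ? ?; apply/eqP; rewrite eqn_leq; apply/andP.
pose I k := index_iota (b k) (b k.+1).
pose L k := [seq i <- I k | P (b k) i] ++ [seq i <- I k | predC (P (b k)) i].
have LI k : perm_eq (L k) (I k) by rewrite perm_filterC.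
have memL k i : (i \in L k) = (b k <= i < b k.+1)%N.
  by rewrite (perm_mem (LI k)) mem_index_iota.
have sizeL k : size (L k) = (b k.+1 - b k)%N by rewrite (perm_size (LI k)) size_iota.
have uniqL k : uniq (L k) by rewrite (perm_uniq (LI k)) iota_uniq.
(* [s] reads the rearranged block at the offset of [n], and [t] returns the position of [n] in it.
   Both preserve blocks, which makes them mutually inverse. *)
pose s n := nth 0%N (L (bl n)) (n - b (bl n)).
pose t n := (b (bl n) + index n (L (bl n)))%N.
have szn n : (n - b (bl n) < size (L (bl n)))%N.
  by rewrite sizeL; have /andP[ln nl] := blP n; rewrite ltn_sub2r.
have bls n : bl (s n) = bl n by apply: blE; rewrite -memL mem_nth.
have mL n : n \in L (bl n) by rewrite memL.
have blt n : bl (t n) = bl n.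
  apply: blE; rewrite leq_addr/= /t -ltn_subRL -sizeL index_mem//.
exists s.
  exists t => n.
    rewrite {1}/t bls /s index_uniq// subnKC//.
    by have /andP[] := blP n.
  by rewrite /s blt /t addKn nth_index.
move=> N; exists (b N), (b N + size [seq i <- I N | P (b N) i])%N; split=> //.
  exact: leq_addr.
rewrite /index_iota addKn; apply: (@eq_from_nth _ 0%N); rewrite size_map size_iota//.
move=> i iF; rewrite (nth_map 0%N) ?size_iota// nth_iota//.
have blN : bl (b N + i)%N = N.
  apply: blE; rewrite leq_addr/= -ltn_subRL -sizeL size_cat.
  exact: leq_trans iF (leq_addr _ _).
by rewrite /s blN addKn nth_cat iF.
Qed.

(* Unbounded subset sums would give infinitely many disjoint finite blocks of sum at
   least 1; a permutation making each block contiguous yields a non-Cauchy series. *)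
Lemma unconditionally_convergent_bounded (R : realType) (H : normedModType R[i])
    (u : nat -> H) : unconditionally_convergent u ->
  exists B : R, forall n (P : pred nat), rnorm (\sum_(0 <= k < n | P k) u k) <= B.
Proof.
move=> uu; apply: contrapT => /forallNP/= unbounded.
(* Indices below [N] contribute at most the sum of the first [N] norms, so a subset sum exceeding
   that by more than 1 has a tail of norm above 1. *)
have big N : exists n P, (N < n)%N /\ 1 < rnorm (\sum_(N <= k < n | P k) u k).
  have /existsNP[n /existsNP[P /negP]] := unbounded (1 + \sum_(0 <= k < N) rnorm (u k)).
  rewrite -ltNge => nP; exists n, P.
  have small m : (m <= N)%N ->
      rnorm (\sum_(0 <= k < m | P k) u k) <= \sum_(0 <= k < N) rnorm (u k).
    move=> mN; rewrite (le_trans (rnorm_sum _ _ _))//.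
    rewrite (big_cat_nat (leq0n _) mN)//= big_mkcond/= ler_wpDr//.
      by apply: sumr_ge0 => k _; exact: rnorm_ge0.
    by apply: ler_sum => k _; case: ifP => // _; exact: rnorm_ge0.
  have Nn : (N < n)%N.
    rewrite ltnNge; apply/negP => /small; rewrite leNgt => /negP; apply.
    by apply: le_lt_trans nP; rewrite lerDr.
  split=> //; move: nP; rewrite (big_cat_nat (leq0n _) (ltnW Nn))//= => /lt_le_trans.
  by move=> /(_ _ (rnormD _ _)); have := small _ (leqnn N); lra.
have [g gP] := choice big; have [P {}gP] := choice gP.
have [s sb sP] := bijective_blocks P (fun N => (gP N).1).
(* Two partial sums within 1/2 of the limit differ by less than 1, against a block sum above 1. *)
have /cvgn_rnormP/(_ (1/2))[|N Nu] := uu s sb; first lra.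
have [p [q [Np pq spq]]] := sP N.
have := (gP p).2; rewrite -big_filter -spq big_map => big1.
have := rnormBD (series (u \o s) q) (series (u \o s) p) (limn (series (u \o s))).
rewrite (rnormBC _ (limn _)).
have -> : series (u \o s) q - series (u \o s) p = \sum_(p <= i < q) u (s i).
  by rewrite /series/= (big_cat_nat (leq0n _) pq)//= addrAC subrr add0r.
have := Nu _ Np; have := Nu _ (leq_trans Np pq).
lra.
Qed.

(** * The uniform boundedness principle *)

Section UniformBoundedness.
Local Open Scope classical_set_scope.
Local Open Scope ring_scope.
Context {R : realType} {V : completeNormedModType R[i]} {W : normedModType R[i]}.

(** The first hypothesis puts each ball inside the previous one. As the radii tend to 0, the centres
    are Cauchy, and their limit lies in every ball. *)
Lemma nested_balls (x : nat -> V) (r : nat -> R) :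
  (forall n, rnorm (x n.+1 - x n) + r n.+1 <= r n) ->
  (forall n, 0 < r n <= 2^-n) ->
  exists z, forall n, rnorm (z - x n) <= r n.
Proof.
move=> nest rn.
have nested n m : (n <= m)%N -> rnorm (x m - x n) + r m <= r n.
  move=> /subnK <-; elim: (m - n)%N => [|k IH].
    by rewrite subrr rnorm0 add0r.
  have := rnormBD (x (k.+1 + n)%N) (x n) (x (k + n)%N).
  by have := nest (k + n)%N; rewrite addSn; lra.
have r_ge0 n : 0 <= r n by have /andP[/ltW] := rn n.
have cx : cvgn x.
  apply: cauchy_rnorm_cvgn => eps e0.
  have [N Ne] : exists N, r N < eps.
    exists (Num.truncn eps^-1).+1.
    have /andP[_ /le_lt_trans] := rn (Num.truncn eps^-1).+1; apply.
    rewrite invf_plt ?posrE ?exprn_gt0//.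
    apply: lt_trans (truncnS_gt _) _.
    by rewrite -natrX ltr_nat ltn_expl.
  exists N => n Nn; rewrite rnormBC; have := nested _ _ Nn; have := r_ge0 n; lra.
exists (limn x) => n.
apply: (@rnorm_lim_le _ _ (fun m => x m - x n)).
  exact: cvgB (cx) (cvg_cst _).
exists n => // m /= nm; have := nested _ _ nm; have := r_ge0 m; lra.
Qed.

(* If the family were not uniformly bounded, there would be nested balls such that
   on the n-th one some [T i] exceeds n in norm; their common point contradicts
   pointwise boundedness. *)
Theorem uniform_boundedness (I : Type) (T : I -> {linear V -> W}) :
  (forall i, exists C : R, forall x, rnorm (T i x) <= C * rnorm x) ->
  (forall x, exists B : R, forall i, rnorm (T i x) <= B) ->
  exists2 K : R, 0 < K & forall i x, rnorm (T i x) <= K * rnorm x.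
Proof.
move=> Tbounded Tpointwise; apply: contrapT => unbounded.
have large K : 0 < K -> exists i x, K * rnorm x < rnorm (T i x).
  move=> K0; apply: contrapT => small; apply: unbounded; exists K => // i x.
  by rewrite leNgt; apply/negP => Kx; apply: small; exists i, x.
(* From stage [p.1] and ball [p.2], [q] is the next ball. Positivity of the radius is a premise
   inside the existential, so that [choice] gives a total function. *)
have step (p : nat * (V * R)) : exists q : V * R, 0 < p.2.2 ->
    [/\ 0 < q.2, q.2 <= p.2.2 / 2, rnorm (q.1 - p.2.1) + q.2 <= p.2.2 &
        exists i, forall z, rnorm (z - q.1) <= q.2 -> p.1%:R < rnorm (T i z)].
  case: p => n [x r] /=; have [r0|?] := ltP 0 r; last by exists (x, r).
  have [B TB] := Tpointwise x.
  (* On the new ball, [|T i z|] will be at least [D - 1 - B], hence at least [n + 1]. *)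
  pose D := `|B| + n%:R + 2.
  have D0 : 0 < D by rewrite /D ltr_wpDl// addr_ge0.
  have [|i [y yP]] := large (D / (r / 2)); first by rewrite !divr_gt0.
  have y0 : 0 < rnorm y.
    rewrite lt_neqAle rnorm_ge0 andbT eq_sym; apply/eqP => /rnorm0_eq0 y0.
    by move: yP; rewrite y0 linear0 !rnorm0 mulr0 ltxx.
  have [C TC] := Tbounded i; pose C' := `|C| + 1.
  have C'0 : 0 < C' by rewrite ltr_wpDl.
  have TC' z : rnorm (T i z) <= C' * rnorm z.
    apply: (le_trans (TC z)); rewrite ler_wpM2r ?rnorm_ge0//.
    by rewrite /C' ler_wpDr// ler_norm.
  (* The centre moves by exactly [r / 2], leaving the other half for the new radius. *)
  pose t := r / 2 / rnorm y; have t0 : 0 < t by rewrite !divr_gt0.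
  pose x' := x + t%:C *: y.
  have x'x : rnorm (x' - x) = r / 2.
    by rewrite /x' addrC addKr rnormZ rnorm_real ?(ltW t0)// divfK// gt_eqF.
  (* The bound [C'^-1] keeps [T i] within 1 of its value at the centre. *)
  exists (x', Num.min (r / 2) (C'^-1)) => _ /=; split.
  - by rewrite lt_min divr_gt0// invr_gt0.
  - by rewrite ge_min lexx.
  - rewrite x'x; have : Num.min (r / 2) C'^-1 <= r / 2 by rewrite ge_min lexx.
    lra.
  - exists i => z; rewrite le_min => /andP[_ zx'].
    have zC : rnorm (T i (x' - z)) <= 1.
      apply: (le_trans (TC' _)).
      by rewrite -ler_pdivlMl// mulr1 rnormBC.
    have big : D <= t * rnorm (T i y).
      apply/ltW; move: yP; rewrite -(ltr_pM2l t0); apply: le_lt_trans.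
      rewrite le_eqVlt; apply/orP; left; apply/eqP.
      by rewrite /t; field; rewrite !gt_eqF.
    have eqTy : t * rnorm (T i y) = rnorm (T i (x' - z) + T i z - T i x).
      rewrite -linearD subrK -linearB /x' addrC addKr linearZ/= rnormZ.
      by rewrite rnorm_real ?(ltW t0).
    have := rnormB (T i (x' - z) + T i z) (T i x).
    have := rnormD (T i (x' - z)) (T i z).
    have := TB i; have := ler_norm B; rewrite -eqTy; rewrite /D in big; lra.
have [f fP] := choice step.
pose a := fix a n := if n is m.+1 then f (m, a m) else (0 : V, 1 : R).
have a0 n : 0 < (a n).2 by elim: n => //= n IH; have [] := fP (n, a n) IH.
have aP n := fP (n, a n) (a0 n).
have [z zP] : exists z, forall n, rnorm (z - (a n).1) <= (a n).2.
  apply: nested_balls => n; first by have [] := aP n.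
  rewrite a0/=; elim: n => [|n IH]; first by rewrite expr0 invr1.
  have [_ + _ _] := aP n; move=> /le_trans; apply.
  by rewrite /= exprSr invfM ler_pM2r// invr_gt0.
have [B TB] := Tpointwise z.
have [_ _ _ [i iP]] := aP (Num.truncn B).+1.
have := iP z (zP (Num.truncn B).+2); rewrite ltNge => /negP; apply.
apply: (le_trans (TB i)); apply/ltW; exact: truncnS_gt.
Qed.

End UniformBoundedness.

(** * Frame bounds and choices of signs *)

Section Frames.
Context {R : realType} {H : normedModType R[i]}.
Variable dot : {dot H for Num.conj}.
Hypothesis hdot : inner_norm dot.

(** The lower bound is asked for every real majorant [S] of the partial sums, so that applications
    stay within finite real sums. *)
Lemma frame_of_partial_sums (v : nat -> H) (A B : R) : 0 < A -> 0 < B ->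
  (forall h n, \sum_(0 <= k < n) rnorm (dot h (v k)) ^+ 2 <= B * rnorm h ^+ 2) ->
  (forall h S, (forall n, \sum_(0 <= k < n) rnorm (dot h (v k)) ^+ 2 <= S) ->
    rnorm h ^+ 2 <= A * S) ->
  frame dot v.
Proof.
move=> A0 B0 upper lower; exists A^-1, (Num.max A^-1 B).
rewrite invr_gt0 A0 le_max lexx; split=> // h.
pose p n := \sum_(0 <= k < n) rnorm (dot h (v k)) ^+ 2.
have pE n : (\sum_(0 <= k < n) (rnorm (dot h (v k)) ^+ 2)%:E = (p n)%:E)%E.
  by rewrite sumEFin.
have t0 n : true -> (0 <= (rnorm (dot h (v n)) ^+ 2)%:E :> \bar R)%E.
  by rewrite lee_fin sqr_ge0.
have sumB : (\sum_(n <oo) (rnorm (dot h (v n)) ^+ 2)%:E <= (B * rnorm h ^+ 2)%:E)%E.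
  apply: lime_le; first by apply: is_cvg_nneseries => n _ _; exact: t0.
  by apply: nearW => n; rewrite pE lee_fin upper.
apply/andP; split; last first.
  by rewrite (le_trans sumB)// lee_fin ler_wpM2r ?sqr_ge0// le_max lexx orbT.
have p_le n : ((p n)%:E <= \sum_(n <oo) (rnorm (dot h (v n)) ^+ 2)%:E)%E.
  by rewrite -pE; apply: nneseries_lim_ge => k _ _; exact: t0.
move: sumB p_le; case: (\sum_(n <oo) _)%E => [S _ pS| |].
- by rewrite lee_fin ler_pdivrMl//; apply: lower => n; rewrite -lee_fin; exact: pS.
- by [].
- by move=> _ /(_ 0%N).
Qed.

(* Greedy choice of signs: by the parallelogram law, the squared norms of [x + y]
   and [x - y] average to [|x|^2 + |y|^2]. Used with [sigma = 1] and [sigma = -1]. *)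
Lemma signs_exist (sigma : R) (v : nat -> H) n : exists eps : nat -> bool,
  sigma * \sum_(0 <= k < n) rnorm (v k) ^+ 2 <=
  sigma * rnorm (\sum_(0 <= k < n) (-1) ^+ eps k *: v k) ^+ 2.
Proof.
elim: n => [|n [eps IH]].
  by exists xpred0; rewrite !big_geq// rnorm0 expr0n.
pose x := \sum_(0 <= k < n) (-1) ^+ eps k *: v k.
have [b xb] : exists b : bool,
    sigma * (rnorm x ^+ 2 + rnorm (v n) ^+ 2) <=
    sigma * rnorm (x + (-1) ^+ b *: v n) ^+ 2.
  have /(congr1 ( *%R sigma)) := rnorm_parallelogram hdot x (v n).
  rewrite mulr2n !mulrDr.
  have [le _|lt eq] := leP (sigma * rnorm x ^+ 2 + sigma * rnorm (v n) ^+ 2)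
    (sigma * rnorm (x + v n) ^+ 2).
    by exists false; rewrite scale1r.
  by exists true; rewrite scaleN1r; lra.
exists (fun k => if k == n then b else eps k).
rewrite !big_nat_recr//= eqxx (eq_big_nat _ _ (F2 := fun k => (-1) ^+ eps k *: v k)).
  by rewrite -/x in IH *; apply: le_trans xb; rewrite !mulrDr lerD2r.
by move=> k /andP[_ kn]; rewrite (ltn_eqF kn).
Qed.

Section SignedSums.
Variables (u w : nat -> H).

(** Length and signs form a single index, so that uniform boundedness applies to the whole family at
    once. *)
Definition signed_sum (p : nat * (nat -> bool)) (f : H) : H :=
  \sum_(0 <= k < p.1) (-1) ^+ p.2 k *: (dot f (w k) *: u k).

Lemma signed_sum_is_linear p : linear (signed_sum p).
Proof.
move=> a f g; rewrite /signed_sum scaler_sumr -big_split/=.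
apply: eq_bigr => k _; rewrite linearPl/= scalerDl scalerDr.
by congr (_ + _); rewrite !scalerA mulrA [_ * a]mulrC.
Qed.

HB.instance Definition _ p :=
  GRing.isLinear.Build _ _ _ _ (signed_sum p) (signed_sum_is_linear p).

End SignedSums.

End Frames.

(** * Frame bounds from bounded signed sums *)

Section UnconditionalBases.
Context {R : realType} {H : completeNormedModType R[i]}.
Variable dot : {dot H for Num.conj}.
Hypothesis hdot : inner_norm dot.

(** For fixed [f], a signed sum is the difference of two subset sums of an unconditionally
    convergent series, hence bounded. *)
Lemma signed_sum_bounded (u w : nat -> H) :
  (forall f, unconditionally_convergent (fun n => dot f (w n) *: u n)) ->
  exists2 K : R, 0 < K & forall p f, rnorm (signed_sum dot u w p f) <= K * rnorm f.
Proof.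
move=> uncond; apply: uniform_boundedness => [p|f].
  exists (\sum_(0 <= k < p.1) rnorm (w k) * rnorm (u k)) => f.
  rewrite (le_trans (rnorm_sum _ _ _))// mulr_suml; apply: ler_sum => k _.
  rewrite rnorm_sign rnormZ mulrAC ler_wpM2r ?rnorm_ge0// mulrC.
  exact: cauchy_schwarz.
have [B uB] := unconditionally_convergent_bounded (uncond f).
exists (B + B) => -[n eps]; rewrite -[X in rnorm X]/(signed_sum dot u w (n, eps) f).
have -> : signed_sum dot u w (n, eps) f =
    \sum_(0 <= k < n | predC eps k) dot f (w k) *: u k -
    \sum_(0 <= k < n | eps k) dot f (w k) *: u k.
  rewrite /signed_sum (bigID eps)/= addrC; congr (_ + _).
    by apply: eq_bigr => k /negPf ->; rewrite scale1r.
  by rewrite -sumrN; apply: eq_bigr => k ->; rewrite scaleN1r.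
by rewrite (le_trans (rnormB _ _))// lerD.
Qed.

Section UnconditionalBasis.
Variables (u w : nat -> H) (N : {linear H -> H}) (C : R).
Hypothesis u1 : forall n, rnorm (u n) = 1.
Hypothesis uncond : forall f, unconditionally_convergent (fun n => dot f (w n) *: u n).
Hypothesis C0 : 0 < C.
Hypothesis NC : forall x, rnorm (N x) <= C * rnorm x.
Hypothesis MN : forall x, limn (series (fun n => dot (N x) (w n) *: u n)) = x.
Hypothesis NM : forall x, N (limn (series (fun n => dot x (w n) *: u n))) = x.
Hypothesis biorth : forall j k, dot (N (u j)) (w k) = (j == k)%:R.

Lemma series_cvgn f : cvgn (series (fun n => dot f (w n) *: u n)).
Proof. by apply: (@uncond f id); exists id. Qed.

Variable K : R.
Hypothesis K0 : 0 < K.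
Hypothesis signedK : forall p f, rnorm (signed_sum dot u w p f) <= K * rnorm f.

Lemma bessel_dual f n :
  \sum_(0 <= k < n) rnorm (dot f (w k)) ^+ 2 <= K ^+ 2 * rnorm f ^+ 2.
Proof.
have [eps] := signs_exist hdot 1 (fun k => dot f (w k) *: u k) n.
rewrite !mul1r => le.
have := signedK (n, eps) f.
rewrite -(@ler_pXn2r _ 2)// ?nnegrE ?mulr_ge0 ?rnorm_ge0 ?(ltW K0)// exprMn.
apply: le_trans; apply: le_trans le; apply: ler_sum => k _.
by rewrite rnormZ u1 mulr1.
Qed.

Lemma synthesis_bound (a : nat -> R[i]) n :
  rnorm (\sum_(0 <= k < n) a k *: u k) ^+ 2 <=
  (K * C) ^+ 2 * \sum_(0 <= k < n) rnorm (a k) ^+ 2.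
Proof.
have [eps] := signs_exist hdot (-1) (fun k => a k *: u k) n.
rewrite !mulN1r lerN2; set y := \sum_(_ <= _ < _) (_ *: _) => le.
(* Biorthogonality reads off [<N y, w k>] as the signed coefficient [a k]; applying the same signs
   again cancels them. *)
have -> : \sum_(0 <= k < n) a k *: u k = signed_sum dot u w (n, eps) (N y).
  apply: eq_big_nat => k /andP[_ kn]; rewrite scalerA; congr (_ *: _).
  rewrite /y linear_sum linear_sumlz/= (big_rem k) ?mem_index_iota//=.
  rewrite big_seq big1 => [|j].
    rewrite addr0 !linearZ/= !linearZl_LR/= biorth eqxx mulr1 mulrA -expr2.
    by rewrite sqrr_sign mul1r.
  rewrite mem_rem_uniq ?iota_uniq// inE => /andP[jk _].
  by rewrite !linearZ/= !linearZl_LR/= biorth (negPf jk) !mulr0.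
have := le_trans (signedK (n, eps) (N y)) (ler_wpM2l (ltW K0) (NC y)).
rewrite mulrA -(@ler_pXn2r _ 2) ?nnegrE ?mulr_ge0 ?rnorm_ge0 ?(ltW K0) ?(ltW C0)//.
rewrite exprMn => /le_trans; apply; rewrite ler_wpM2l ?sqr_ge0//.
apply: (le_trans le); apply: ler_sum => k _.
by rewrite rnormZ u1 mulr1.
Qed.

(** Below: [1 = <N (u n), w n>] and Cauchy-Schwarz. Above: keeping only the [n]-th term of the
    Bessel bound at [f = w n] gives [|w n|^4 <= K^2 |w n|^2]. *)
Lemma dual_semi_normalized : semi_normalized w.
Proof.
have wge n : C^-1 <= rnorm (w n).
  rewrite -[_^-1]mulr1 ler_pdivrMl//.
  have := cauchy_schwarz hdot (N (u n)) (w n); rewrite biorth eqxx.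
  have -> : rnorm (1 : R[i]) = 1 by rewrite /rnorm normr1.
  move/le_trans; apply; rewrite ler_wpM2r ?rnorm_ge0//.
  by rewrite (le_trans (NC _))// u1 mulr1.
have wle n : rnorm (w n) <= K.
  have w0 : 0 < rnorm (w n) by apply: lt_le_trans (wge n); rewrite invr_gt0.
  have := bessel_dual (w n) n.+1; rewrite big_nat_recr//= (rnorm_dot_self hdot).
  have := sumr_ge0 (index_iota 0 n) (P := xpredT)
    (F := fun k => rnorm (dot (w n) (w k)) ^+ 2).
  move=> /(_ (fun k _ => sqr_ge0 _)) s0 le.
  have : rnorm (w n) ^+ 2 * rnorm (w n) ^+ 2 <= K ^+ 2 * rnorm (w n) ^+ 2.
    by rewrite -expr2; apply: le_trans le; rewrite lerDr.
  by rewrite ler_pM2r ?exprn_gt0// ler_pXn2r ?nnegrE ?rnorm_ge0 ?(ltW K0).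
exists C^-1, K; split; first by rewrite invr_gt0.
  exact: le_trans (wge 0%N) (wle 0%N).
by move=> n; rewrite wge wle.
Qed.

(** For the lower bound, [h = N (M h)] gives [|h| <= C |M h|], and [synthesis_bound] passes to the
    limit to control [M h]. *)
Lemma frame_dual : frame dot w.
Proof.
apply: (@frame_of_partial_sums _ _ _ _ (C ^+ 2 * (K * C) ^+ 2) (K ^+ 2)).
- by rewrite !(mulr_gt0, exprn_gt0).
- by rewrite exprn_gt0.
- exact: bessel_dual.
move=> h S hS.
rewrite -[h in rnorm h]NM.
apply: (@le_trans _ _ (C ^+ 2 * rnorm (limn (series (fun n => dot h (w n) *: u n))) ^+ 2)).
  by rewrite -exprMn ler_pXn2r ?nnegrE ?mulr_ge0 ?rnorm_ge0 ?(ltW C0).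
rewrite -mulrA ler_wpM2l ?sqr_ge0//.
apply: rnorm_lim_sqr_le (@series_cvgn h) _ => n.
by rewrite (le_trans (synthesis_bound _ _))// ler_wpM2l ?sqr_ge0.
Qed.

(** Upper bound: for [y] the sum of the [<h, u k> u k], [S = <h, y>] while [|y|^2 <= (K C)^2 S];
    Cauchy-Schwarz and division by [S] conclude. Lower bound: expand [<h, h>] through
    [h = M (N h)]. *)
Lemma frame_basis : frame dot u.
Proof.
have KC0 : 0 < (K * C) ^+ 2 by rewrite exprn_gt0// mulr_gt0.
apply: (frame_of_partial_sums KC0 KC0) => [h n|h S hS].
  set S := \sum_(_ <= _ < _) _.
  have := synthesis_bound (fun k => dot h (u k)) n.
  set y := \sum_(_ <= _ < _) _; rewrite -/S => yS.
  have S_dot : rnorm (dot h y) = S.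
    have S0 : 0 <= S by apply: sumr_ge0 => k _; exact: sqr_ge0.
    rewrite -[RHS]rnorm_real//; congr rnorm.
    rewrite /y linear_sumr /S rmorph_sum/=; apply: eq_bigr => k _.
    by rewrite linearZr_LR/= rmorphXn/= rnormE normCKC.
  have := cauchy_schwarz hdot h y; rewrite S_dot => S_le.
  have [S0|S0] := leP S 0.
    by apply: (le_trans S0); rewrite mulr_ge0 ?sqr_ge0.
  rewrite -(ler_pM2r S0) -expr2 mulrAC.
  apply: (@le_trans _ _ (rnorm h ^+ 2 * rnorm y ^+ 2)).
    by rewrite -exprMn ler_pXn2r ?nnegrE ?mulr_ge0 ?rnorm_ge0 ?(ltW S0).
  by rewrite mulrC ler_wpM2r ?sqr_ge0.
(* AM-GM: [2 |a_k| |b_k| <= |a_k|^2 / D + D |b_k|^2] with [D = (K C)^2],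
   for [a_k = <N h, w_k>] and [b_k = <h, u_k>]. *)
set D := (K * C) ^+ 2.
have Nh n : \sum_(0 <= k < n) rnorm (dot (N h) (w k)) ^+ 2 <= D * rnorm h ^+ 2.
  rewrite (le_trans (bessel_dual _ _))// /D exprMn -[leRHS]mulrA ler_wpM2l ?sqr_ge0//.
  by rewrite -exprMn ler_pXn2r ?nnegrE ?mulr_ge0 ?rnorm_ge0 ?(ltW C0).
(* Absorbing half of [|h|^2] into the left side leaves [|h|^2 <= D S]. *)
have : rnorm (dot h h) <= (rnorm h ^+ 2 + D * S) / 2.
  have := @series_cvgn (N h); rewrite MN => /(rnorm_dot_lim_le hdot); apply=> n.
  rewrite /series/= linear_sumr (le_trans (rnorm_sum _ _ _))//.
  apply: (@le_trans _ _ ((D^-1 * \sum_(0 <= k < n) rnorm (dot (N h) (w k)) ^+ 2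
      + D * \sum_(0 <= k < n) rnorm (dot h (u k)) ^+ 2) / 2)).
    rewrite !mulr_sumr -big_split/= mulr_suml; apply: ler_sum => k _.
    rewrite linearZr_LR/= rnormM rnorm_conj.
    set a := rnorm _; set b := rnorm _.
    have : 0 <= D^-1 * (a - D * b) ^+ 2 by rewrite mulr_ge0 ?sqr_ge0// invr_ge0 ltW.
    have -> : D^-1 * (a - D * b) ^+ 2 = D^-1 * a ^+ 2 - 2 * (a * b) + D * b ^+ 2.
      by field; rewrite gt_eqF.
    lra.
  rewrite ler_pM2r ?invr_gt0//; apply: lerD.
    by rewrite ler_pdivrMl.
  by rewrite ler_pM2l.
rewrite (rnorm_dot_self hdot); lra.
Qed.

End UnconditionalBasis.

End UnconditionalBases.

Theorem proposition4p7 (R : realType) (H : completeNormedModType R[i])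
    (dot : {dot H for Num.conj}) (hdot : inner_norm dot)
    (e : nat -> H) (he : orthonormal_basis dot e)
    (phi psi : nat -> H) (m : nat -> R[i])
    (hcvg : multiplier_unconditionally_convergent dot m phi psi)
    (hinv : invertible_operator (multiplier dot m phi psi))
    (hmin : minimal_seq phi) :
  (exists c d : nat -> R[i],
     [/\ forall n, m n = c n * Num.conj (d n),
         semi_normalized (fun n => c n *: phi n),
         semi_normalized (fun n => d n *: psi n),
         frame dot (fun n => c n *: phi n) &
         frame dot (fun n => d n *: psi n)]) /\
  (exists c d : nat -> R[i],
     [/\ forall n, m n = c n * Num.conj (d n),
         frame dot (fun n => c n *: phi n) &
         frame dot (fun n => d n *: psi n)]).
Proof.
(* The same sequences serve both properties. *)
suff : exists c d : nat -> R[i],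
    [/\ forall n, m n = c n * Num.conj (d n),
        semi_normalized (fun n => c n *: phi n),
        semi_normalized (fun n => d n *: psi n),
        frame dot (fun n => c n *: phi n) &
        frame dot (fun n => d n *: psi n)].
  by move=> ex; split=> //; case: ex => c [d [mcd _ _ fc fd]]; exists c, d.
have [N [[C1 NC1] MN NM]] := hinv.
pose C := `|C1| + 1; have C0 : 0 < C by rewrite ltr_wpDl.
have NC x : rnorm (N x) <= C * rnorm x.
  by rewrite (le_trans (NC1 x))// ler_wpM2r ?rnorm_ge0// /C ler_wpDr// ler_norm.
pose r n := `|phi n| : R[i].
have r0 n : r n != 0 by rewrite normr_eq0 minimal_seq_neq0.
pose c n := (r n)^-1; pose d n := r n * Num.conj (m n).
pose u n := c n *: phi n; pose w n := d n *: psi n.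
have conj_d n : Num.conj (d n) = r n * m n.
  by rewrite /d rmorphM/= conjCK conj_Creal// normr_real.
have mcd n : m n = c n * Num.conj (d n) by rewrite conj_d mulKf.
have termE f : (fun n => dot f (w n) *: u n) = multiplier_term dot m phi psi f.
  apply/funext => n; rewrite /multiplier_term /w /u linearZr_LR/= scalerA.
  by congr (_ *: _); rewrite [in RHS]mcd mulrC mulrA.
have u1 n : rnorm (u n) = 1.
  by apply: complexI; rewrite rnormE normrZ normfV normr_id (mulVf (r0 n)).
have uncond f : unconditionally_convergent (fun n => dot f (w n) *: u n).
  by rewrite termE; exact: hcvg.
have uMN x : limn (series (fun n => dot (N x) (w n) *: u n)) = x.
  by rewrite termE; exact: (congr1 (@^~ x) MN).
have uNM x : N (limn (series (fun n => dot x (w n) *: u n))) = x.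
  by rewrite termE; exact: (congr1 (@^~ x) NM).
have biorth j k : dot (N (u j)) (w k) = (j == k)%:R.
  have coef : m k * dot (N (phi j)) (psi k) = (j == k)%:R.
    apply: (minimal_seq_coef hmin (a := fun k => m k * dot (N (phi j)) (psi k))).
    have := series_cvgn uncond (f := N (phi j)); rewrite uMN.
    by rewrite termE.
  (* Normalization multiplies the coefficient by [c j * r k], which is 1 on the diagonal. *)
  have -> : N (u j) = c j *: N (phi j) by rewrite linearZ.
  rewrite linearZl_LR linearZr_LR/= conj_d -mulrA coef.
  by case: eqP => [->|_]; rewrite ?mulr0// mulr1 mulVf.
have [K K0 signedK] := signed_sum_bounded hdot uncond.
exists c, d; split=> //.
- by exists 1, 1; split=> // n; rewrite -/(u n) u1 lexx.
- exact: (dual_semi_normalized hdot u1 C0 NC biorth K0 signedK).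
- exact: (frame_basis hdot u1 uncond C0 NC uMN biorth K0 signedK).
- exact: (frame_dual hdot u1 uncond C0 NC uNM biorth K0 signedK).
Qed.
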